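(* Let $x\in(0,1)$ and let $\mu^{(x)}$ be the joint distribution of $(\zeta(x),\zeta(1))$ as in the context. Then the Hausdorff dimension of the measure $\mu^{(x)}$ satisfies $$\dim_{\mathrm{H}}\mu^{(x)}\ge2-\frac{\log(1+x)}{\log2}.$$
   Context: Let $(Q_n)_{n\ge1}$ be i.i.d. random variables taking values $0$ and $1$ with probability $1/2$ each, and independently let $(U_n)_{n\ge1}$ be i.i.d. uniform on $[0,1]$. For $y\in(0,1]$ let $T_n(y)=\sum_{j=1}^n\mathbbm{1}_{\{U_j\le y\}}$ (with $T_0(y)=0$) and $$\zeta(y)=\sum_{n=1}^\infty(1/2)^{T_{n-1}(y)}Q_n\mathbbm{1}_{\{U_n\le y\}}.$$ The Hausdorff dimension of a Borel probability measure $\mu$ on $\mathbb{R}^2$ is $\inf\{\dim_{\mathrm{H}}E: E\text{ Borel},\ \mu(E)=1\}$. *)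

(* Defs.v *)
From HB Require Import structures.
From mathcomp Require Import all_boot all_order all_algebra.
From mathcomp Require Import all_classical all_reals all_analysis.
Set Implicit Arguments. Unset Strict Implicit. Unset Printing Implicit Defensive.
Import Order.TTheory GRing.Theory Num.Theory.
Import numFieldNormedType.Exports.
Local Open Scope classical_set_scope.
Local Open Scope ring_scope.

Definition edist {R : realType} (p q : R * R) : R :=
  Num.sqrt ((p.1 - q.1) ^+ 2 + (p.2 - q.2) ^+ 2).

(* Euclidean diameter (as an extended real; -oo for the empty set, never used) *)
Definition ediam {R : realType} (A : set (R * R)) : \bar R :=
  ereal_sup [set e | exists p q, A p /\ A q /\ e = (edist p q)%:E].

Definition hterm {R : realType} (s : R) (A : set (R * R)) : \bar R :=
  if `[< A = set0 >] then 0%E else ((fine (ediam A)) `^ s)%:E.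

Definition hcontent {R : realType} (s delta : R) (E : set (R * R)) : \bar R :=
  ereal_inf [set (\sum_(0 <= i <oo) hterm s (F i))%E
            | F in [set F : nat -> set (R * R) |
                    E `<=` \bigcup_i F i /\ forall i, (ediam (F i) <= delta%:E)%E]].

(* s-dimensional Hausdorff measure H^s(E) = lim_{delta -> 0} H^s_delta(E)
   (= sup over delta > 0, by monotonicity) *)
Definition hmeasure {R : realType} (s : R) (E : set (R * R)) : \bar R :=
  ereal_sup [set hcontent s delta E | delta in [set delta : R | 0 < delta]].

Definition hdim {R : realType} (E : set (R * R)) : \bar R :=
  ereal_inf [set s%:E | s in [set s : R | 0 <= s /\ hmeasure s E = 0%E]].

Definition hdim_measure {R : realType} (mu : set (R * R) -> \bar R) : \bar R :=
  ereal_inf [set hdim E | E in [set E : set (R * R) | measurable E /\ mu E = 1%E]].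

Definition mutually_independent {d} {T : measurableType d} {R : realType}
  {I : eqType} (P : probability T R) (X : I -> T -> R) : Prop :=
  (forall i, measurable_fun setT (X i)) /\
  forall (J : seq I) (B : I -> set R), uniq J -> (forall i, measurable (B i)) ->
    P (\bigcap_(i in [set` J]) (X i @^-1` B i)) =
    (\prod_(i <- J) P (X i @^-1` B i))%E.

Definition QU_family {T : Type} {R : realType} (Q U : nat -> T -> R)
  (i : nat + nat) : T -> R :=
  match i with inl n => Q n | inr n => U n end.

(* 0-based indexing: Q_{n+1}, U_{n+1} of the paper are Q n, U n here. *)

Definition Tcount {T : Type} {R : realType} (U : nat -> T -> R) (y : R)
  (n : nat) (w : T) : nat :=
  (\sum_(j < n) nat_of_bool (U j w <= y)%R)%N.

Definition zeta {T : Type} {R : realType} (Q U : nat -> T -> R) (y : R) (w : T) : R :=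
  limn (fun N : nat => \sum_(n < N)
          ((2 : R)^-1 ^+ (Tcount U y n w) * Q n w * (nat_of_bool (U n w <= y))%:R)).

(* Main.v *)
Require Import Defs.
From HB Require Import structures.
From mathcomp Require Import all_boot all_order all_algebra.
From mathcomp Require Import all_classical all_reals all_analysis.
From mathcomp Require Import measurable_realfun ring lra.
Import Order.TTheory GRing.Theory Num.Theory.
Import numFieldNormedType.Exports.
Local Open Scope classical_set_scope.
Local Open Scope ring_scope.

(* Cylinder estimate: fix binary words a and b. The probability that the digits of
   zeta(1) start with a and those of zeta(x) start with b is at most
   2^-(|a|+|b|) (1+x)^|a|. By induction on time: each step uses up a digit of a
   (factor 1/2), and with probability x it also uses up a digit of b; giving up the
   factor 1/2 for that second digit costs 2, hence the factor 2x + (1-x) = 1+x.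
   So mu^(x) charges a square of side 2^-m by at most 9 ((1+x)/4)^m = 9 (2^-m)^D
   with D = 2 - log(1+x)/log 2, and the mass distribution principle bounds the
   Hausdorff measure of every set of full measure away from 0. *)

(** * Binary words and dyadic intervals *)

(** The leading digit has weight 1, as in [zeta]: infinite expansions fill [[0, 2]], and a word of
    length [m] fixes an interval of length [2 * 2^-m]. *)
Definition bval {R : realType} (s : seq bool) : R :=
  foldr (fun (b : bool) (v : R) => b%:R + v / 2) 0 s.

Lemma bval_cat {R : realType} (s t : seq bool) :
  bval (s ++ t) = bval s + 2^-1 ^+ size s * bval t :> R.
Proof.
elim: s => [|b s IH] /=; first by rewrite expr0 mul1r add0r.
by rewrite IH exprS; field.
Qed.

Lemma bval_ge0 {R : realType} (s : seq bool) : 0 <= bval s :> R.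
Proof. by elim: s => //= b s IH; rewrite addr_ge0// divr_ge0. Qed.

Lemma bval_le2 {R : realType} (s : seq bool) : bval s <= 2 :> R.
Proof. by elim: s => //= -[] s IH /=; lra. Qed.

Definition bnat (s : seq bool) : nat := foldl (fun z (b : bool) => (z.*2 + b)%N) 0%N s.

Lemma bnat_rcons (s : seq bool) (b : bool) : bnat (rcons s b) = ((bnat s).*2 + b)%N.
Proof. by rewrite /bnat -cats1 foldl_cat. Qed.

(** Places words of a given length on a regular grid, so that neighbouring intervals have
    consecutive integer indices. *)
Lemma bval_bnat {R : realType} (s : seq bool) :
  bval s = 2 * 2^-1 ^+ size s * (bnat s)%:R :> R.
Proof.
elim/last_ind: s => [|s b IH]; first by rewrite mulr0.
rewrite -cats1 bval_cat IH cats1 size_rcons bnat_rcons natrD -mul2n natrM exprS /=.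
by field.
Qed.

(** Keeps only the low [m] bits: an index beyond [2^m - 1] still yields a word of length [m], a
    harmless extra candidate. *)
Fixpoint bits (m z : nat) : seq bool :=
  if m is m'.+1 then rcons (bits m' z./2) (odd z) else [::].

Lemma size_bits (m z : nat) : size (bits m z) = m.
Proof. by elim: m z => //= m IH z; rewrite size_rcons IH. Qed.

Lemma bitsK (s : seq bool) : bits (size s) (bnat s) = s.
Proof.
elim/last_ind: s => // s b IH; rewrite size_rcons bnat_rcons /=.
by rewrite addnC half_bit_double IH oddD odd_double addbF; case: b.
Qed.

(** With [h = 2^-m], the interval [[2hn, 2h(n+1)]] meets [[p-h, p+h]] only if
    [p/(2h) - 3/2 <= n <= p/(2h) + 1/2]; this is the lower end, rounded down, and 0 if negative. *)
Definition window {R : realType} (p : R) (m : nat) : nat :=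
  Num.truncn (p / (2 * 2^-1 ^+ m) - 3 / 2).

(* With [v = 2 h (n + theta)], [0 <= theta <= 1], the integer [n] lies in an
   interval of length 2, so it takes at most three values. *)
Lemma bits_window {R : realType} (s : seq bool) (v p : R) :
  bval s <= v <= bval s + 2 * 2^-1 ^+ size s -> `|v - p| <= 2^-1 ^+ size s ->
  exists2 k, (k < 3)%N &
    s = bits (size s) (window p (size s) + k)%N.
Proof.
rewrite /window bval_bnat; set h := _ ^+ _ => /andP[v1 v2]; rewrite ler_norml => /andP[p1 p2].
have h0 : 0 < h by rewrite exprn_gt0// invr_gt0.
set z := p / _ - _; set i := Num.truncn z; set n := bnat s.
have zp : 2 * h * z = p - 3 * h.
  by rewrite /z mulrBr mulrCA divff ?mulr1 ?mulf_neq0 ?lt0r_neq0//; field.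
have n1 : n%:R <= z + 2.
  rewrite -(ler_pM2l (_ : 0 < 2 * h)) ?mulr_gt0// mulrDr zp /n; lra.
have n2 : z <= n%:R.
  rewrite -(ler_pM2l (_ : 0 < 2 * h)) ?mulr_gt0// zp /n; lra.
have i_n : (i <= n)%N.
  have [z0|z0] := leP 0 z; last by rewrite /i truncn_floor leNgt z0.
  rewrite -(ler_nat R); apply: le_trans n2.
  by rewrite truncn_le.
exists (n - i)%N; last by rewrite subnKC// bitsK.
rewrite ltn_subLR// -(ltr_nat R) natrD.
have := truncnS_gt z; rewrite -natr1 -/i; lra.
Qed.

(** * Finite model: independent pairs of a digit and a selection bit *)

Definition obs_weight {R : realType} (x : R) (e : bool * bool) : R :=
  2^-1 * (if e.2 then x else 1 - x).

(* Probability of [phi] for a list of [N] independent pairs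
   (fair bit, selection bit of parameter [x]). *)
Fixpoint obs_prob {R : realType} (x : R) (N : nat) (phi : pred (seq (bool * bool))) : R :=
  if N is N'.+1 then
    \sum_(q : bool) \sum_(u : bool)
      obs_weight x (q, u) * obs_prob x N' (fun s => phi ((q, u) :: s))
  else (phi [::])%:R.

Lemma obs_weight_ge0 {R : realType} (x : R) (e : bool * bool) :
  0 <= x <= 1 -> 0 <= obs_weight x e.
Proof. by rewrite /obs_weight; case: e.2 => /andP[x0 x1]; lra. Qed.

Lemma eq_obs_prob {R : realType} (x : R) (N : nat) (phi psi : pred (seq (bool * bool))) :
  phi =1 psi -> obs_prob x N phi = obs_prob x N psi.
Proof.
elim: N phi psi => [|N IH] phi psi e /=; first by rewrite e.
by do 2 (apply: eq_bigr => ? _); congr (_ * _); apply: IH => s; rewrite e.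
Qed.

Lemma obs_prob_andb {R : realType} (x : R) (N : nat) (c : bool)
    (phi : pred (seq (bool * bool))) :
  obs_prob x N (fun s => c && phi s) = c%:R * obs_prob x N phi.
Proof.
case: c => /=; first by rewrite mul1r.
rewrite mul0r; elim: N {phi} => //= N IH.
by rewrite big1// => ? _; rewrite big1// => ? _; rewrite IH mulr0.
Qed.

Lemma obs_prob_unselected {R : realType} (x : R) (N : nat) :
  obs_prob x N (all (fun e => ~~ e.2)) = (1 - x) ^+ N.
Proof.
elim: N => // N IH.
transitivity (\sum_(q : bool) \sum_(u : bool)
    obs_weight x (q, u) * ((~~ u)%:R * (1 - x) ^+ N)).
  by do 2 (apply: eq_bigr => ? _); rewrite -IH -obs_prob_andb.
by rewrite !big_bool exprS /obs_weight /=; field.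
Qed.

Definition selected (s : seq (bool * bool)) : seq bool := [seq e.1 | e <- s & e.2].

(** Here [a] concerns [zeta(1)], which reads every digit, and [b] concerns [zeta(x)], which reads
    the selected ones. *)
Definition cell (a b : seq bool) (s : seq (bool * bool)) : bool :=
  prefix a (unzip1 s) && prefix b (selected s).

Definition starts (q : bool) (a : seq bool) : bool :=
  if a is a0 :: _ then a0 == q else true.

(** A digit is always compared with the head of [a], and with the head of [b] only when selected.
    Empty words impose no condition and stay empty under [behead]. *)
Lemma cell_cons (a b : seq bool) (q u : bool) (s : seq (bool * bool)) :
  cell a b ((q, u) :: s) =
  (starts q a && (u ==> starts q b)) && cell (behead a) (if u then behead b else b) s.
Proof.
rewrite /cell /selected /=; case: u; case: a b => [|a0 a] [|b0 b] //=; rewrite ?prefix0s //;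
  by do ?[case: (_ == _) => //=]; do ?[case: (prefix _ _) => //=].
Qed.

(** The induction keeps [a] and [b] general since each step may shorten both. The bound is uniform
    in [N], as needed for the limit in time. *)
Lemma obs_prob_cell {R : realType} (x : R) (N : nat) (a b : seq bool) : 0 <= x <= 1 ->
  obs_prob x N (cell a b) <= 2^-1 ^+ (size a + size b) * (1 + x) ^+ size a.
Proof.
move=> x01; have /andP[x0 x1] := x01.
have pos (k l : nat) : 0 <= (2^-1 ^+ k * (1 + x) ^+ l :> R).
  by rewrite mulr_ge0// exprn_ge0// ?invr_ge0// addr_ge0.
elim: N a b => [|N IH] a b.
  by rewrite /= /cell; case: a b => [|a0 a] [|b0 b] /=; rewrite ?pos// !expr0 mulr1.
have step q u : obs_prob x N (fun s => cell a b ((q, u) :: s)) <=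
    (starts q a && (u ==> starts q b))%:R * (2^-1 ^+ (size (behead a) +
      size (if u then behead b else b)) * (1 + x) ^+ size (behead a)).
  by rewrite (eq_obs_prob _ _ _ _ (cell_cons a b q u)) obs_prob_andb ler_wpM2l// IH.
rewrite /=; set rhs := leRHS.
apply: (@le_trans _ _ (\sum_(q : bool) \sum_(u : bool) obs_weight x (q, u) *
  ((starts q a && (u ==> starts q b))%:R * (2^-1 ^+ (size (behead a) +
      size (if u then behead b else b)) * (1 + x) ^+ size (behead a))))).
  by do 2 (apply: ler_sum => ? _); rewrite ler_wpM2l// obs_weight_ge0.
rewrite {}/rhs !big_bool /obs_weight /= {step IH}.
case: a b => [|a0 a] [|b0 b] /=.
- rewrite expr0; lra.
(* Only selected steps now cost a factor 1/2, and dropping a digit of [b] doubles the bound: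
   [(1 - x) + 2 * (x / 2) = 1]. *)
- have := pos (size b) 0%N; rewrite !add0n exprS expr0.
  by set t := _ ^+ size b; case: b0 => /=; lra.
(* Only the factor 1/2 for the digit of [a] arises; the factor [1 + x >= 1] is slack. *)
- have := pos (size a) (size a); rewrite !addn0 !exprS.
  set t := _ ^+ size a; set s := _ ^+ size a; case: a0 => /=; nra.
(* Equality [(1 - x) + 2 * x = 1 + x] if the heads agree; otherwise the selected branch contributes
   0. *)
- have := pos (size a + size b)%N (size a); rewrite !addnS !addSn !exprS.
  set t := _ ^+ (_ + _); set s := _ ^+ size a.
  case: a0; case: b0 => /=; nra.
Qed.

(** * Digits along a sample path *)

Definition obs {T : Type} {R : realType} (Q U : nat -> T -> R) (x : R)
    (n N : nat) (w : T) : seq (bool * bool) :=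
  [seq (Q i w == 1, U i w <= x) | i <- iota n N].

Lemma obs_cat {T : Type} {R : realType} (Q U : nat -> T -> R) (x : R) (n N M : nat) (w : T) :
  obs Q U x n (N + M) w = obs Q U x n N w ++ obs Q U x (n + N) M w.
Proof. by rewrite /obs iotaD map_cat. Qed.

Lemma selected_cat (s t : seq (bool * bool)) :
  selected (s ++ t) = selected s ++ selected t.
Proof. by rewrite /selected filter_cat map_cat. Qed.

(** Kept in the exact form found under [limn] in [zeta], so that folding identifies the two. *)
Definition zeta_part {T : Type} {R : realType} (Q U : nat -> T -> R) (y : R)
    (w : T) (N : nat) : R :=
  \sum_(n < N) ((2 : R)^-1 ^+ (Tcount U y n w) * Q n w * (nat_of_bool (U n w <= y))%:R).

Lemma Tcount_obs {T : Type} {R : realType} (Q U : nat -> T -> R) (y : R) (N : nat) (w : T) :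
  Tcount U y N w = size (selected (obs Q U y 0 N w)).
Proof.
elim: N => [|N IH]; first by rewrite /Tcount big_ord0.
rewrite -addn1 obs_cat selected_cat size_cat -IH /Tcount addn1 big_ord_recr /=.
by rewrite /selected /=; case: ifP.
Qed.

(** The exponent [Tcount] is the number of digits selected earlier, so the selected digits, in
    order, form a binary expansion. *)
Lemma zeta_part_obs {T : Type} {R : realType} (Q U : nat -> T -> R) (y : R) (w : T) (N : nat) :
  (forall i, Q i w = 0 \/ Q i w = 1) ->
  zeta_part Q U y w N = bval (selected (obs Q U y 0 N w)).
Proof.
move=> Q01; elim: N => [|N IH]; first by rewrite /zeta_part big_ord0.
rewrite -addn1 obs_cat selected_cat bval_cat -IH /zeta_part addn1 big_ord_recr /=.
rewrite (Tcount_obs Q) /selected /=; congr (_ + _); rewrite -mulrA; congr (_ * _).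
case: (U N w <= y) => /=; rewrite ?mulr0// mulr1 mul0r addr0.
by case: (Q01 N) => ->; rewrite ?eqxx// eq_sym oner_eq0.
Qed.

(** All digits after [a] together contribute between 0 and [2 * 2^-|a|], at every later time, so the
    bounds survive the limit. *)
Lemma zeta_part_bounds {T : Type} {R : realType} (Q U : nat -> T -> R) (y : R) (w : T)
    (N M : nat) (a : seq bool) :
  (forall i, Q i w = 0 \/ Q i w = 1) ->
  prefix a (selected (obs Q U y 0 N w)) -> (N <= M)%N ->
  bval a <= zeta_part Q U y w M <= bval a + 2 * 2^-1 ^+ size a.
Proof.
move=> Q01 /prefixP[t e] NM; rewrite zeta_part_obs// -(subnKC NM) obs_cat selected_cat e.
rewrite -catA bval_cat; set t' := _ ++ _.
have h0 : 0 <= (2^-1 ^+ size a : R) by rewrite exprn_ge0// invr_ge0.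
by rewrite lerDl mulr_ge0 ?bval_ge0//= lerD2l mulrC ler_wpM2r ?bval_le2.
Qed.

Lemma is_cvg_zeta_part {T : Type} {R : realType} (Q U : nat -> T -> R) (y : R) (w : T) :
  (forall i, Q i w = 0 \/ Q i w = 1) -> cvgn (zeta_part Q U y w).
Proof.
move=> Q01; apply: nondecreasing_is_cvgn; last first.
  by exists 2 => _ [N _ <-]; rewrite zeta_part_obs// bval_le2.
move=> N M NM.
(* Taking as prefix the whole word selected up to [N] gives monotonicity. *)
have /andP[le _] := zeta_part_bounds Q U y w N M _ Q01 (prefix_refl _) NM.
by apply: le_trans le; rewrite zeta_part_obs.
Qed.

Lemma zeta_bounds {T : Type} {R : realType} (Q U : nat -> T -> R) (y : R) (w : T)
    (N : nat) (a : seq bool) :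
  (forall i, Q i w = 0 \/ Q i w = 1) ->
  prefix a (selected (obs Q U y 0 N w)) ->
  bval a <= zeta Q U y w <= bval a + 2 * 2^-1 ^+ size a.
Proof.
move=> Q01 pa; have c := is_cvg_zeta_part Q U y w Q01.
rewrite /zeta -/(zeta_part Q U y w); apply/andP; split.
  by apply: limr_ge => //; exists N => // M /= NM; have /andP[] := zeta_part_bounds _ _ _ _ _ _ _ Q01 pa NM.
by apply: limr_le => //; exists N => // M /= NM; have /andP[] := zeta_part_bounds _ _ _ _ _ _ _ Q01 pa NM.
Qed.

(** * From the finite model to the probability space *)

Lemma measure_bigsetU_le {d : measure_display} {T : measurableType d} {R : realType}
    (P : probability T R) {I : Type} (s : seq I) (F : I -> set T) :
  (forall i, measurable (F i)) ->
  (P (\big[setU/set0]_(i <- s) F i) <= \sum_(i <- s) P (F i))%E.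
Proof.
move=> mF; elim: s => [|i s IH]; first by rewrite !big_nil measure0.
rewrite !big_cons; apply: (le_trans (measureU2 P (mF i) _)); last exact: leeD2l.
by apply: bigsetU_measurable.
Qed.

Lemma measurable_obs1 {d : measure_display} {T : measurableType d} {R : realType}
    (Q U : nat -> T -> R) (x : R) (n : nat) (e : bool * bool) :
  (forall i, measurable_fun setT (Q i)) -> (forall i, measurable_fun setT (U i)) ->
  measurable [set w | (Q n w == 1, U n w <= x) = e].
Proof.
move=> mQ mU; case: e => q u.
rewrite (_ : [set w | _] = ((fun w => Q n w == 1) @^-1` [set q]) `&`
                           ((fun w => U n w <= x) @^-1` [set u])).
  apply: measurableI.
    by rewrite -[X in measurable X]setTI; apply: measurable_fun_eqr.
  by rewrite -[X in measurable X]setTI; apply: measurable_fun_ler.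
by apply/seteqP; split=> w /= [-> ->].
Qed.

Lemma obs_event_cons {T : Type} {R : realType} (Q U : nat -> T -> R) (x : R)
    (n N : nat) (phi : pred (seq (bool * bool))) :
  [set w | phi (obs Q U x n N.+1 w)] =
  \big[setU/set0]_(e : bool * bool)
    ([set w | (Q n w == 1, U n w <= x) = e] `&`
     [set w | phi (e :: obs Q U x n.+1 N w)]).
Proof.
rewrite -bigcup_seq; apply/seteqP; split => w /=.
  by move=> pw; exists (Q n w == 1, U n w <= x); rewrite //= mem_index_enum.
by move=> [e _ [/= <-]].
Qed.

Lemma measurable_obs {d : measure_display} {T : measurableType d} {R : realType}
    (Q U : nat -> T -> R) (x : R) (n N : nat) (phi : pred (seq (bool * bool))) :
  (forall i, measurable_fun setT (Q i)) -> (forall i, measurable_fun setT (U i)) ->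
  measurable [set w | phi (obs Q U x n N w)].
Proof.
move=> mQ mU; elim: N n phi => [|N IH] n phi.
  case p0: (phi [::]).
    by rewrite (_ : [set w | _] = setT)//; apply/seteqP; split.
  by rewrite (_ : [set w | _] = set0)//; apply/seteqP; split => // w; rewrite /= p0.
rewrite obs_event_cons; apply: bigsetU_measurable => e _.
by apply: measurableI; [exact: measurable_obs1|exact: (IH _ (fun s => phi (e :: s)))].
Qed.

Lemma prob_uniform_le {d : measure_display} {T : measurableType d} {R : realType}
    (P : probability T R) (U : T -> R) (x : R) :
  (forall B : set R, measurable B -> P (U @^-1` B) = lebesgue_measure (B `&` `[0, 1]%classic)) ->
  0 <= x <= 1 -> P (U @^-1` `]-oo, x]%classic) = x%:E.
Proof.
move=> PU /andP[x0 x1]; rewrite PU//.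
rewrite (_ : _ `&` _ = `[0, x]%classic).
  by rewrite lebesgue_measure_itv /= lte_fin oppr0 adde0; case: ltgtP x0 => // <-.
apply/seteqP; split => z /=; rewrite !in_itv /=; first by case=> -> /andP[->].
by move=> /andP[-> zx]; rewrite zx (le_trans zx x1).
Qed.

Lemma prob_obs_eq {d : measure_display} {T : measurableType d} {R : realType}
    (P : probability T R) (Q U : nat -> T -> R) (x : R) (l : seq (bool * bool)) :
  mutually_independent P (QU_family Q U) ->
  (forall n, P (Q n @^-1` [set 1]) = (2^-1)%:E) ->
  (forall n (B : set R), measurable B ->
     P (U n @^-1` B) = lebesgue_measure (B `&` `[0, 1]%classic)) ->
  0 <= x <= 1 ->
  P [set w | obs Q U x 0 (size l) w = l] = (\prod_(e <- l) obs_weight x e)%:E.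
Proof.
move=> [mX indep] PQ PU x01.
pose z := (false, false).
(* A false digit means [Q <> 1] rather than [Q = 0], which makes the set equality below exact. The
   default [z] is never read on the indices in [J]. *)
pose B (i : nat + nat) : set R := match i with
  | inl i => if (nth z l i).1 then [set 1] else ~` [set 1]
  | inr i => if (nth z l i).2 then `]-oo, x]%classic else ~` `]-oo, x]%classic end.
have mB i : measurable (B i).
  by case: i => i /=; case: ifP => _ //; apply: measurableC.
pose J := [seq inl i | i <- iota 0 (size l)] ++ [seq inr i | i <- iota 0 (size l)] : seq (nat + nat).
have uJ : uniq J.
  rewrite cat_uniq !map_inj_uniq ?iota_uniq//; try by move=> ? ? [].
  by rewrite andbT; apply/hasPn => _ /mapP[i _ ->]; apply/negP => /mapP[].
have mQ i : measurable (Q i @^-1` [set 1]).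
  by rewrite -[X in measurable X]setTI; apply: (mX (inl i)).
have mU i : measurable (U i @^-1` `]-oo, x]%classic).
  by rewrite -[X in measurable X]setTI; apply: (mX (inr i)).
have PB i : P (Q i @^-1` B (inl i)) = (2^-1)%:E /\
    P (U i @^-1` B (inr i)) = (if (nth z l i).2 then x else 1 - x)%:E.
  split=> /=; case: ifP => _.
  - by rewrite PQ.
  - rewrite -preimage_setC probability_setC ?mQ// PQ -EFinB; congr EFin; lra.
  - by rewrite (prob_uniform_le _ _ _ (PU i) x01).
  - by rewrite -preimage_setC probability_setC ?mU// (prob_uniform_le _ _ _ (PU i) x01).
rewrite (_ : [set w | _] = \bigcap_(i in [set` J]) (QU_family Q U i @^-1` B i)).
  rewrite indep// /J big_cat !big_map /=.
  under eq_bigr => i _ do rewrite (PB i).1.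
  under [X in (_ * X)%E]eq_bigr => i _ do rewrite (PB i).2.
  rewrite !prodEFin -EFinM -big_split (big_nth z) /index_iota subn0; congr EFin.
apply/seteqP; split => w /=.
  move=> ow; have lE j : (j < size l)%N -> nth z l j = (Q j w == 1, U j w <= x).
    by move=> jl; rewrite -{1}ow (nth_map 0%N) ?size_iota// nth_iota.
  move=> i; rewrite /= mem_cat => /orP[] /mapP[j]; rewrite mem_iota add0n /= => jl -> /=;
    rewrite lE//=; first by case: eqP.
  by case: ifP => [|/negbT/negP] h; rewrite /= in_itv.
move=> H; apply: (@eq_from_nth _ z); rewrite ?size_map ?size_iota// => i il.
rewrite (nth_map 0%N) ?size_iota// nth_iota// add0n.
have il' : i \in iota 0 (size l) by rewrite mem_iota.
have Hq : (B (inl i)) (Q i w) by apply: (H (inl i)); rewrite /= mem_cat map_f.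
have Hu : (B (inr i)) (U i w) by apply: (H (inr i)); rewrite /= mem_cat map_f ?orbT.
move: Hq Hu => /=; case: (nth z l i) => -[] [] /=; rewrite ?in_itv /=.
- by move=> -> ->; rewrite eqxx.
- by move=> -> /negP/negPf ->; rewrite eqxx.
- by move=> /eqP/negPf -> ->.
- by move=> /eqP/negPf -> /negP/negPf ->.
Qed.

(** Splitting on successive observations reduces the event to cylinders of known probability;
    subadditivity gives the inequality, which suffices. *)
Lemma prob_obs_le {d : measure_display} {T : measurableType d} {R : realType}
    (P : probability T R) (Q U : nat -> T -> R) (x : R) (N : nat) (phi : pred (seq (bool * bool))) :
  mutually_independent P (QU_family Q U) ->
  (forall n, P (Q n @^-1` [set 1]) = (2^-1)%:E) ->
  (forall n (B : set R), measurable B ->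
     P (U n @^-1` B) = lebesgue_measure (B `&` `[0, 1]%classic)) ->
  0 <= x <= 1 ->
  (P [set w | phi (obs Q U x 0 N w)] <= (obs_prob x N phi)%:E)%E.
Proof.
move=> ind PQ PU x01.
have mQ i : measurable_fun setT (Q i) by apply: (ind.1 (inl i)).
have mU i : measurable_fun setT (U i) by apply: (ind.1 (inr i)).
(* Generalized over the word [l] already observed: each induction step appends one observation to
   it. *)
suff H l : (P ([set w | obs Q U x 0 (size l) w = l] `&`
    [set w | phi (obs Q U x (size l) N w)]) <=
    (\prod_(e <- l) obs_weight x e * obs_prob x N phi)%:E)%E.
  have := H [::]; rewrite /= big_nil mul1r.
  by rewrite (_ : [set w | obs _ _ _ 0 0 w = _] = setT) ?setTI//; apply/seteqP.
have mcyl l' : measurable [set w | obs Q U x 0 (size l') w = l'].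
  rewrite (_ : [set w | _] = [set w | obs Q U x 0 (size l') w == l']).
    exact: (measurable_obs Q U x 0 (size l') (fun s => s == l')).
  by apply/seteqP; split=> w /= /eqP.
elim: N phi l => [|N IH] phi l.
  rewrite /=; case: (phi [::]); last first.
    by rewrite mulr0 (_ : _ `&` _ = set0) ?measure0//; apply/seteqP; split => // w [].
  rewrite mulr1 (_ : [set w | _ true] = setT) ?setIT; last by apply/seteqP.
  by rewrite (prob_obs_eq P Q U x).
rewrite obs_event_cons setIC big_distrl /=.
apply: le_trans.
  apply: measure_bigsetU_le => e; apply: measurableI => //; apply: measurableI.
    exact: measurable_obs1.
  exact: (measurable_obs Q U x _ _ (fun s => phi (e :: s))).
have -> : \prod_(e <- l) obs_weight x e * obs_prob x N.+1 phi =
    \sum_(e : bool * bool) (\prod_(e' <- rcons l e) obs_weight x e' *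
      obs_prob x N (fun s => phi (e :: s))).
  rewrite /= pair_bigA mulr_sumr; apply: eq_bigr => -[q u] _.
  by rewrite -cats1 big_cat big_seq1 mulrA.
rewrite -sumEFin; apply: lee_sum => e _; apply: le_trans (IH _ (rcons l e)).
rewrite size_rcons; apply: le_measure; rewrite ?inE.
- apply: measurableI => //; apply: measurableI; first exact: measurable_obs1.
  exact: (measurable_obs Q U x _ _ (fun s => phi (e :: s))).
- apply: measurableI; first by rewrite -(size_rcons l e).
  exact: (measurable_obs Q U x _ _ (fun s => phi (e :: s))).
- by move=> w /= [[oe ph] ol]; split=> //; rewrite -addn1 obs_cat ol add0n /obs /= oe cats1.
Qed.

(** The weights of one pair sum to 1, so the first [n] pairs integrate out. *)
Lemma obs_prob_drop {R : realType} (x : R) (n N : nat) (phi : pred (seq (bool * bool))) :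
  obs_prob x (n + N) (fun s => phi (drop n s)) = obs_prob x N phi.
Proof.
elim: n => [|n IH]; first by apply: eq_obs_prob => s; rewrite drop0.
rewrite addSn /= -[RHS]mul1r.
rewrite (eq_bigr (fun q => \sum_(u : bool) obs_weight x (q, u) * obs_prob x N phi)).
  by rewrite !big_bool /obs_weight /=; field.
by move=> q _; apply: eq_bigr => u _; rewrite IH.
Qed.

(** A union over times, because the time at which enough digits have been selected to read [b] is
    random. *)
Definition cylinder {T : Type} {R : realType} (Q U : nat -> T -> R) (x : R)
    (a b : seq bool) : set T :=
  \bigcup_N [set w | cell a b (obs Q U x 0 N w)].

Lemma measurable_cylinder {d : measure_display} {T : measurableType d} {R : realType}
    (Q U : nat -> T -> R) (x : R) (a b : seq bool) :
  (forall i, measurable_fun setT (Q i)) -> (forall i, measurable_fun setT (U i)) ->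
  measurable (cylinder Q U x a b).
Proof. by move=> mQ mU; apply: bigcup_measurable => N _; apply: measurable_obs. Qed.

(** Continuity from below: the events increase with [N], and their bound does not depend on [N]. *)
Lemma prob_cylinder_le {d : measure_display} {T : measurableType d} {R : realType}
    (P : probability T R) (Q U : nat -> T -> R) (x : R) (a b : seq bool) :
  mutually_independent P (QU_family Q U) ->
  (forall n, P (Q n @^-1` [set 1]) = (2^-1)%:E) ->
  (forall n (B : set R), measurable B ->
     P (U n @^-1` B) = lebesgue_measure (B `&` `[0, 1]%classic)) ->
  0 <= x <= 1 ->
  (P (cylinder Q U x a b) <= (2^-1 ^+ (size a + size b) * (1 + x) ^+ size a)%:E)%E.
Proof.
move=> ind PQ PU x01.
have mQ i : measurable_fun setT (Q i) by apply: (ind.1 (inl i)).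
have mU i : measurable_fun setT (U i) by apply: (ind.1 (inr i)).
have ndF : nondecreasing_seq (fun N => [set w | cell a b (obs Q U x 0 N w)]).
  move=> N M NM; apply/subsetPset => w /= /andP[pa pb].
  rewrite -(subnKC NM) obs_cat /cell selected_cat /unzip1 map_cat.
  by rewrite !prefix_catl.
have cv := nondecreasing_cvg_mu (mu := P)
  (fun N => measurable_obs Q U x 0 N _ mQ mU) (measurable_cylinder Q U x a b mQ mU) ndF.
rewrite -(cvg_lim _ cv)//; apply: lime_le; first by apply/cvg_ex; eexists; exact: cv.
apply: nearW => N /=; apply: (le_trans (prob_obs_le P Q U x N _ ind PQ PU x01)).
by rewrite lee_fin obs_prob_cell.
Qed.

(** * Almost sure behaviour of the digits *)

Lemma negligible_setC {d : measure_display} {T : measurableType d} {R : realType}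
    (P : probability T R) (A : set T) :
  measurable A -> P A = 1%E -> P.-negligible (~` A).
Proof.
move=> mA PA; apply/negligibleP; first exact: measurableC.
by apply: etrans (probability_setC P mA) _; rewrite PA -EFinB subrr.
Qed.

(** The second clause makes [zeta(1)] read every digit; the third says that [zeta(x)] reads
    infinitely many. *)
Definition typical {T : Type} {R : realType} (Q U : nat -> T -> R) (x : R) (w : T) : Prop :=
  [/\ forall i, Q i w = 0 \/ Q i w = 1, forall i, U i w <= 1 &
      forall m, exists N, (m <= size (selected (obs Q U x 0 N w)))%N].

Lemma negligible_untypical {d : measure_display} {T : measurableType d} {R : realType}
    (P : probability T R) (Q U : nat -> T -> R) (x : R) :
  mutually_independent P (QU_family Q U) ->
  (forall n, P (Q n @^-1` [set 0]) = (2^-1)%:E /\ P (Q n @^-1` [set 1]) = (2^-1)%:E) ->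
  (forall n (B : set R), measurable B ->
     P (U n @^-1` B) = lebesgue_measure (B `&` `[0, 1]%classic)) ->
  0 < x <= 1 ->
  P.-negligible [set w | ~ typical Q U x w].
Proof.
move=> ind PQ PU /andP[x0 x1].
have mQ i : measurable_fun setT (Q i) by apply: (ind.1 (inl i)).
have mU i : measurable_fun setT (U i) by apply: (ind.1 (inr i)).
have mQ1 i (c : R) : measurable (Q i @^-1` [set c]).
  by rewrite -[X in measurable X]setTI; apply: mQ.
have mU1 i : measurable (U i @^-1` `]-oo, 1]%classic).
  by rewrite -[X in measurable X]setTI; apply: mU.
pose B1 := \bigcup_i ~` (Q i @^-1` [set 0] `|` Q i @^-1` [set 1]).
pose B2 := \bigcup_i ~` (U i @^-1` `]-oo, 1]%classic).
(* Nothing is selected from some time [n] on; for each [n] this has probability at most [(1 - x)^N]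
   for all [N], hence 0. *)
pose B3 := \bigcup_n \bigcap_N [set w | all (fun e => ~~ e.2) (obs Q U x n N w)].
apply: (@negligibleS _ _ _ _ (B1 `|` (B2 `|` B3))).
  move=> w /= nt; apply: contrapT => /not_orP[nB1 /not_orP[nB2 nB3]]; apply: nt; split.
  - move=> i; apply: contrapT => h; apply: nB1; exists i => //= h'; exact: h.
  - move=> i; apply: contrapT => h; apply: nB2; exists i => //=; by rewrite in_itv.
  - elim=> [|m [N mN]]; first by exists 0%N.
    have [N' hN'] : exists N', ~~ all (fun e => ~~ e.2) (obs Q U x N N' w).
      apply: contrapT => h; apply: nB3; exists N => // N' _ /=; apply: contrapT => h'.
      by apply: h; exists N'; apply/negP.
    exists (N + N')%N; rewrite obs_cat selected_cat size_cat -addn1 leq_add// add0n.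
    rewrite size_map size_filter -has_count; move: hN'; rewrite -has_predC.
    by apply: sub_has => e /=; rewrite negbK.
apply: negligibleU; last apply: negligibleU.
- apply: negligible_bigcup => i; apply: negligible_setC; first exact: measurableU.
  rewrite measureU//; first by rewrite [X in (X + _)%E](PQ i).1 [X in (_ + X)%E](PQ i).2 -EFinD; congr EFin; lra.
  by apply/seteqP; split => // w /= [->] /eqP; rewrite eq_sym oner_eq0.
- apply: negligible_bigcup => i; apply: negligible_setC => //.
  by rewrite (prob_uniform_le _ _ _ (PU i)) ?ler01 ?lexx.
- apply: negligible_bigcup => n.
  pose F N := [set w | all (fun e : bool * bool => ~~ e.2) (obs Q U x n N w)].
  have mF N : measurable (F N) by apply: measurable_obs.
  apply/negligibleP; first exact: bigcapT_measurable.
  apply/eqP; rewrite eq_le measure_ge0 andbT.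
  have le N : (P (\bigcap_N F N) <= ((1 - x) ^+ N)%:E)%E.
    apply: (@le_trans _ _ (P (F N))).
      by apply: le_measure; rewrite ?inE//; [exact: bigcapT_measurable|exact: bigcap_inf].
    (* That estimate starts at time 0, so the block starting at [n] is seen as the tail of [n + N]
       observations. *)
    have := prob_obs_le P Q U x (n + N) (fun s => all (fun e => ~~ e.2) (drop n s)) ind
      (fun n => (PQ n).2) PU.
    rewrite (ltW x0) x1 => /(_ isT).
    rewrite (obs_prob_drop x n N (all (fun e => ~~ e.2))) obs_prob_unselected.
    by under eq_set => w do rewrite obs_cat drop_size_cat ?size_map ?size_iota//.
  have cv : ((1 - x) ^+ N)%:E @[N --> \oo] --> (0 : R)%:E.
    by apply: cvg_EFin; [exact: nearW|apply: cvg_expr; rewrite ger0_norm; lra].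
  suff : (P (\bigcap_N F N) <= limn (fun N => ((1 - x) ^+ N)%:E))%E by rewrite (cvg_lim _ cv).
  apply: lime_ge; first by apply/cvg_ex; eexists; exact: cv.
  by apply: nearW => N; exact: le.
Qed.

(** * Measurability of [zeta] *)

(** All quantifiers range over integers, so the set of convergence is built by countable
    operations. *)
Lemma cvgn_cauchyP {R : realType} (u : nat -> R) :
  cvgn u <-> forall k, exists N, forall i j, `|u (N + i)%N - u (N + j)%N| <= k.+1%:R^-1.
Proof.
split=> [/cvg_cauchy/cauchy_ballP cu k|cu].
  have k0 : 0 < (k.+1%:R^-1 : R) by rewrite invr_gt0.
  have [[A B] /= [[N _ NA] [M _ MB]] AB] := cu _ k0.
  exists (maxn N M) => i j; apply/ltW; apply: (AB (_, _)); split => /=.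
    by apply: NA => /=; rewrite (leq_trans (leq_maxl N M))// leq_addr.
  by apply: MB => /=; rewrite (leq_trans (leq_maxr N M))// leq_addr.
apply: cauchy_cvg; apply/cauchy_ballP => e e0.
have [k ke] : exists k, (k.+1%:R^-1 : R) < e.
  exists (Num.truncn e^-1); rewrite invf_plt ?posrE//; exact: truncnS_gt.
have [N HN] := cu k.
exists ([set u n | n in [set n | (N <= n)%N]], [set u n | n in [set n | (N <= n)%N]]) => /=.
  by split; exists N => // n /= Nn; exists n.
move=> [_ _] /= [[i Ni <-] [j Nj <-]]; apply: le_lt_trans ke.
by have := HN (i - N)%N (j - N)%N; rewrite !subnKC.
Qed.

Lemma measurable_cvgn {d : measure_display} {T : measurableType d} {R : realType}
    (f : nat -> T -> R) : (forall n, measurable_fun setT (f n)) ->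
  measurable [set w | cvgn (f ^~ w)].
Proof.
move=> mf.
rewrite (_ : [set w | _] = \bigcap_k \bigcup_N \bigcap_i \bigcap_j
    [set w | `|f (N + i)%N w - f (N + j)%N w| <= k.+1%:R^-1]).
  apply: bigcapT_measurable => k; apply: bigcupT_measurable => N.
  apply: bigcapT_measurable => i; apply: bigcapT_measurable => j.
  rewrite -[X in measurable X]setTI.
  have mg : measurable_fun setT (fun w => `|f (N + i)%N w - f (N + j)%N w| <= k.+1%:R^-1).
    apply: measurable_fun_ler => //.
    by apply: measurableT_comp => //; apply: measurable_funB.
  exact: (mg measurableT [set true]).
apply/seteqP; split=> w /=.
  move=> /cvgn_cauchyP cu k _; have [N HN] := cu k.
  by exists N => // i _ j _; apply: HN.
move=> H; apply/cvgn_cauchyP => k; have [N _ HN] := H k I.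
by exists N => i j; apply: HN.
Qed.

(* [limn] is [0] on divergent sequences, so it is the limit of the sequence
   truncated to [0] off the set of convergence. *)
Lemma measurable_limn {d : measure_display} {T : measurableType d} {R : realType}
    (f : nat -> T -> R) : (forall n, measurable_fun setT (f n)) ->
  measurable_fun setT (fun w => limn (f ^~ w)).
Proof.
move=> mf; pose C := [set w | cvgn (f ^~ w)].
have mC : measurable C by apply: measurable_cvgn.
apply: (@measurable_fun_cvg _ _ _ _ (fun n w => f n w * \1_C w)).
  by move=> n; apply: measurable_funM => //; apply: measurable_indic.
move=> w _; have [Cw|nCw] := pselect (C w).
  by rewrite indicE mem_set//; under eq_cvg do rewrite mulr1.
rewrite (dvgP nCw) indicE memNset//; under eq_cvg do rewrite mulr0; exact: cvg_cst.
Qed.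

Lemma measurable_zeta {d : measure_display} {T : measurableType d} {R : realType}
    (Q U : nat -> T -> R) (y : R) :
  (forall i, measurable_fun setT (Q i)) -> (forall i, measurable_fun setT (U i)) ->
  measurable_fun setT (zeta Q U y).
Proof.
move=> mQ mU.
have mle n : measurable_fun setT (fun w => U n w <= y).
  exact: measurable_fun_ler.
have mif n (a b : R) : measurable_fun setT (fun w => if U n w <= y then a else b).
  exact: measurable_fun_ifT.
apply: (measurable_limn (fun N w => zeta_part Q U y w N)) => N.
apply: measurable_sum => n; apply: measurable_funM; first apply: measurable_funM => //.
  (* The power with random exponent becomes a finite product of measurable factors. *)
  rewrite (_ : (fun w => _) = (fun w => \prod_(j < n) (if U j w <= y then 2^-1 else 1))).
    by apply: measurable_prod => j _; apply: mif.
  apply/funext => w; rewrite /Tcount expr_sum; apply: eq_bigr => j _.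
  by case: (_ <= _); rewrite ?expr1 ?expr0.
rewrite (_ : (fun w => _) = (fun w => if U n w <= y then 1 else 0)); first exact: mif.
by apply/funext => w; case: (_ <= _).
Qed.

(** * Mass of small squares *)

(** Three candidate words per coordinate give nine cylinders. The coordinates swap: [p.2] locates
    [zeta(1)], the first word of [cylinder]. *)
Definition box_event {T : Type} {R : realType} (Q U : nat -> T -> R) (x : R)
    (p : R * R) (m : nat) : set T :=
  \big[setU/set0]_(k : 'I_3 * 'I_3)
    cylinder Q U x (bits m (window p.2 m + k.1)) (bits m (window p.1 m + k.2)).

Lemma box_event_mem {T : Type} {R : realType} (Q U : nat -> T -> R) (x : R) (p : R * R)
    (m : nat) (w : T) :
  typical Q U x w ->
  `|zeta Q U x w - p.1| <= 2^-1 ^+ m -> `|zeta Q U 1 w - p.2| <= 2^-1 ^+ m ->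
  box_event Q U x p m w.
Proof.
move=> [Q01 U1 inf] hx h1; have [N mN] := inf m.
set s := obs Q U x 0 N w.
(* Since all [U i w <= 1], every digit is selected at level 1. *)
have s1 : selected (obs Q U 1 0 N w) = unzip1 s.
  rewrite /selected /s /obs; elim: (iota 0 N) => //= i l IH.
  by rewrite U1 /= IH.
have mN' : (m <= size (unzip1 s))%N.
  apply: leq_trans mN _; rewrite -/s /selected size_map size_filter.
  by rewrite [leqRHS]size_map count_size.
have sz t : (m <= size t)%N -> size (take m t) = m by move=> /size_takel.
have p1 : prefix (take m (unzip1 s)) (selected (obs Q U 1 0 N w)).
  by rewrite s1 prefix_take.
have px : prefix (take m (selected s)) (selected s) by rewrite prefix_take.
have [|k k3 ek] := bits_window _ _ p.2 (zeta_bounds Q U 1 w N _ Q01 p1).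
  by rewrite sz.
have [|k' k'3 ek'] := bits_window _ _ p.1 (zeta_bounds Q U x w N _ Q01 px).
  by rewrite sz.
rewrite !sz// in ek ek'.
rewrite /box_event -bigcup_seq; exists (Ordinal k3, Ordinal k'3).
  by rewrite /= mem_index_enum.
by exists N => //=; rewrite /cell -ek -ek' !prefix_take.
Qed.

Lemma prob_box_event {d : measure_display} {T : measurableType d} {R : realType}
    (P : probability T R) (Q U : nat -> T -> R) (x : R) (p : R * R) (m : nat) :
  mutually_independent P (QU_family Q U) ->
  (forall n, P (Q n @^-1` [set 1]) = (2^-1)%:E) ->
  (forall n (B : set R), measurable B ->
     P (U n @^-1` B) = lebesgue_measure (B `&` `[0, 1]%classic)) ->
  0 <= x <= 1 ->
  (P (box_event Q U x p m) <= (9 * ((1 + x) / 4) ^+ m)%:E)%E.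
Proof.
move=> ind PQ PU x01; rewrite /box_event; apply: le_trans.
  apply: measure_bigsetU_le => k; apply: measurable_cylinder => i.
    exact: (ind.1 (inl i)).
  exact: (ind.1 (inr i)).
apply: (@le_trans _ _ (\sum_(k : 'I_3 * 'I_3) (((1 + x) / 4) ^+ m)%:E)%E).
  apply: lee_sum => k _; apply: (le_trans (prob_cylinder_le P Q U x _ _ ind PQ PU x01)).
  rewrite !size_bits lee_fin exprD -!exprMn.
  by rewrite (_ : 2^-1 * 2^-1 * (1 + x) = (1 + x) / 4 :> R)//; field.
by rewrite sumEFin lee_fin sumr_const card_prod card_ord mulr_natl.
Qed.

(** * The exponent and sets of small diameter *)

(** This fixes the exponent [D]: the bound [((1 + x) / 4)^m] becomes [(2^-m)^D]. *)
Lemma half_powR_dim {R : realType} (x : R) : 0 < 1 + x ->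
  2^-1 `^ (2 - ln (1 + x) / ln 2) = (1 + x) / 4.
Proof.
move=> x0; have l2 : ln 2 != 0 :> R by rewrite gt_eqF// ln_gt0// ltr1n.
rewrite /powR gt_eqF ?invr_gt0// lnV ?posrE//.
have -> : (2 - ln (1 + x) / ln 2) * - ln 2 = ln (1 + x) - (ln 2 + ln 2) by field.
rewrite expRD lnK ?posrE// expRN expRD lnK ?posrE//.
by congr (_ / _); rewrite -natrM.
Qed.

Lemma edist_fst {R : realType} (p q : R * R) : `|p.1 - q.1| <= Defs.edist p q.
Proof. by rewrite -sqrtr_sqr ler_wsqrtr// lerDl sqr_ge0. Qed.

Lemma edist_snd {R : realType} (p q : R * R) : `|p.2 - q.2| <= Defs.edist p q.
Proof. by rewrite -sqrtr_sqr ler_wsqrtr// lerDr sqr_ge0. Qed.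

(** The bound by 1 keeps the diameter finite; [fine] would send an infinite one to 0. *)
Lemma edist_le_ediam {R : realType} (F : set (R * R)) (p q : R * R) :
  (ediam F <= 1)%E -> F p -> F q -> Defs.edist p q <= fine (ediam F).
Proof.
move=> F1 Fp Fq.
have le : ((Defs.edist p q)%:E <= ediam F)%E.
  by apply: ereal_sup_ubound; exists p, q.
rewrite -lee_fin fineK// fin_numElt (lt_le_trans _ le) ?ltNyr//.
by rewrite (le_lt_trans F1)// ltry.
Qed.

Lemma dyadic_scale {R : realType} (r : R) : 0 < r <= 1 ->
  exists m, 2^-1 ^+ m.+1 < r <= 2^-1 ^+ m.
Proof.
move=> /andP[r0 r1].
have ex : exists m, 2^-1 ^+ m < r.
  have : 2^-1 ^+ n @[n --> \oo] --> (0 : R).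
    by apply: cvg_expr; rewrite ger0_norm ?invr_ge0// invf_lt1// ltr1n.
  move=> /cvgrPdist_lt /(_ _ r0) [n _ /(_ n (leqnn n))].
  by rewrite sub0r normrN ger0_norm ?exprn_ge0 ?invr_ge0// => ?; exists n.
(* The least exponent with [2^-m < r] is positive because [r <= 1]; its predecessor is the scale
   sought. *)
case: (ex_minnP ex) => -[|m] mr mmin; first by move: mr; rewrite expr0 ltNge r1.
exists m; rewrite mr /= leNgt; apply/negP => /mmin.
by rewrite ltnn.
Qed.

(* Frostman-type estimate: intersecting over all admissible scales covers
   sets of zero diameter as well. *)
Lemma small_set_event {d : measure_display} {T : measurableType d} {R : realType}
    (P : probability T R) (Q U : nat -> T -> R) (x s : R) (F : set (R * R)) :
  mutually_independent P (QU_family Q U) ->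
  (forall n, P (Q n @^-1` [set 1]) = (2^-1)%:E) ->
  (forall n (B : set R), measurable B ->
     P (U n @^-1` B) = lebesgue_measure (B `&` `[0, 1]%classic)) ->
  0 <= x < 1 -> s <= 2 - ln (1 + x) / ln 2 -> (ediam F <= 1)%E ->
  exists V : set T, [/\ measurable V,
    forall w, typical Q U x w -> F (zeta Q U x w, zeta Q U 1 w) -> V w &
    (P V <= 36%:E * hterm s F)%E].
Proof.
move=> ind PQ PU /andP[x0 x1] sD F1; set D := 2 - _ in sD.
have [->|/set0P[p Fp]] := eqVneq F set0.
  by exists set0; split => //; rewrite measure0 /hterm; case: asboolP => // _; rewrite mule0.
have -> : hterm s F = ((fine (ediam F)) `^ s)%:E.
  by rewrite /hterm; case: asboolP => // F0; move: Fp; rewrite F0.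
set r := fine (ediam F).
have r0 : 0 <= r by apply: le_trans (edist_le_ediam F p p F1 Fp Fp); exact: sqrtr_ge0.
have r1 : r <= 1.
  have : ((Defs.edist p p)%:E <= ediam F)%E by apply: ereal_sup_ubound; exists p, p.
  by rewrite /r; case: (ediam F) F1 => //= t; rewrite lee_fin.
pose V := \bigcap_(m in [set m | r <= 2^-1 ^+ m]) box_event Q U x p m.
have mbox m : measurable (box_event Q U x p m).
  apply: bigsetU_measurable => k _; apply: measurable_cylinder => i.
    exact: (ind.1 (inl i)).
  exact: (ind.1 (inr i)).
have mV : measurable V by apply: bigcap_measurable => //; exists 0%N; rewrite /= expr0.
have PV m : r <= 2^-1 ^+ m -> (P V <= (9 * ((1 + x) / 4) ^+ m)%:E)%E.
  move=> rm; apply: (@le_trans _ _ (P (box_event Q U x p m))).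
    by apply: le_measure; rewrite ?inE//; apply: bigcap_inf.
  by apply: prob_box_event => //; rewrite x0 ltW.
exists V; split => //.
  move=> w tw Fw m /= rm; apply: box_event_mem => //.
    exact: (le_trans (edist_fst (_, _) p)) (le_trans (edist_le_ediam F _ _ F1 Fw Fp) rm).
  exact: (le_trans (edist_snd (_, _) p)) (le_trans (edist_le_ediam F _ _ F1 Fw Fp) rm).
rewrite -EFinM.
have [re|rn0] := eqVneq r 0.
  apply: (@le_trans _ _ 0%E); last by rewrite lee_fin mulr_ge0// powR_ge0.
  have cv : (9 * ((1 + x) / 4) ^+ m)%:E @[m --> \oo] --> (9 * 0 : R)%:E.
    apply: cvg_EFin; first exact: nearW.
    by apply: cvgMr; apply: cvg_expr; rewrite ger0_norm; lra.
  suff : (P V <= limn (fun m => (9 * ((1 + x) / 4) ^+ m)%:E))%E by rewrite (cvg_lim _ cv)// mulr0.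
  apply: lime_ge; first by apply/cvg_ex; eexists; exact: cv.
  by apply: nearW => m; apply: PV; rewrite re exprn_ge0// invr_ge0.
have rp : 0 < r by rewrite lt_neqAle eq_sym rn0.
have [m /andP[mr rm]] : exists m, 2^-1 ^+ m.+1 < r <= 2^-1 ^+ m.
  by apply: dyadic_scale; rewrite rp.
(* The 9 counts cylinders; the 4 bounds [2^D], lost in replacing [2^-m] by [2 * r]. *)
apply: (le_trans (PV m rm)); rewrite lee_fin (_ : 36 = 9 * 4)//; last by rewrite -natrM.
rewrite -mulrA ler_wpM2l//.
have x10 : 0 < 1 + x by rewrite ltr_wpDr.
rewrite -(half_powR_dim x x10) -/D.
have D0 : 0 <= D.
  rewrite /D subr_ge0 ler_pdivrMr ?ln_gt0 ?ltr1n//.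
  apply: (@le_trans _ _ (ln 2)); last by rewrite ler_peMl// ?ln_ge0// ler1n.
  by rewrite ler_ln ?posrE//; lra.
have D2 : D <= 2.
  by rewrite /D lerBlDr lerDl divr_ge0// ln_ge0 ?ler1n//; lra.
have h0 : 0 <= 2^-1 ^+ m :> R by rewrite exprn_ge0// invr_ge0.
have -> : (2^-1 `^ D) ^+ m = (2^-1 ^+ m) `^ D.
  by rewrite -powR_mulrn ?powR_ge0// -powRrM mulrC powRrM powR_mulrn ?invr_ge0.
apply: (@le_trans _ _ ((2 * r) `^ D)).
  by rewrite ge0_ler_powR ?nnegrE ?mulr_ge0//; move: mr; rewrite exprS; lra.
rewrite powRM// ler_pM ?powR_ge0//.
  apply: (@le_trans _ _ (2 `^ 2)); first by rewrite ler_powR// ler1n.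
  by rewrite powR_mulrn// -natrX.
(* As [r <= 1], lowering the exponent from [D] to [s] only increases the power. *)
by rewrite ger_powR// rp.
Qed.

(** * The mass distribution principle *)

Theorem theorem7p3 (d : measure_display) (T : measurableType d) (R : realType)
  (P : probability T R) (Q U : nat -> T -> R) (x : R) :
  mutually_independent P (QU_family Q U) ->
  (forall n, P (Q n @^-1` [set 0]) = (2^-1)%:E /\ P (Q n @^-1` [set 1]) = (2^-1)%:E) ->
  (forall n (B : set R), measurable B ->
     P (U n @^-1` B) = lebesgue_measure (B `&` `[0, 1]%classic)) ->
  0 < x < 1 ->
  ((2 - ln (1 + x) / ln 2)%:E <=
     hdim_measure (fun E : set (R * R) =>
       P ((fun w => (zeta Q U x w, zeta Q U 1 w)) @^-1` E)))%E.
Proof.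
move=> ind PQ PU /andP[x0 x1].
have mQ i : measurable_fun setT (Q i) by apply: (ind.1 (inl i)).
have mU i : measurable_fun setT (U i) by apply: (ind.1 (inr i)).
apply: le_ereal_inf_tmp => _ /= [E [mE PE] <-].
apply: le_ereal_inf_tmp => _ /= [s [s0 Hs] <-]; rewrite lee_fin leNgt; apply/negP => /ltW sD.
have mZ : measurable ((fun w => (zeta Q U x w, zeta Q U 1 w)) @^-1` E).
  rewrite -[X in measurable X]setTI.
  by apply: (measurable_fun_pair (measurable_zeta Q U x mQ mU) (measurable_zeta Q U 1 mQ mU)).
have [B [mB PB sB]] : P.-negligible [set w | ~ typical Q U x w].
  by apply: negligible_untypical => //; rewrite x0 ltW.
(* An exponent [s] below the bound would have zero Hausdorff measure, yet the content at scale 1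
   already bounds that measure below. *)
suff le : ((36^-1)%:E <= hcontent s 1 E)%E.
  have : (hcontent s 1 E <= hmeasure s E)%E by apply: ereal_sup_ubound; exists 1 => //=; exact: ltr01.
  by rewrite Hs => /(le_trans le); rewrite lee_fin leNgt invr_gt0 ltr0n.
apply: le_ereal_inf_tmp => _ /= [F [EF F1] <-].
(* Covering sets are arbitrary, perhaps not measurable, so measurable events stand in for their
   preimages. *)
have /choice[V HV] : forall i, exists V : set T, [/\ measurable V,
    forall w, typical Q U x w -> F i (zeta Q U x w, zeta Q U 1 w) -> V w &
    (P V <= 36%:E * hterm s (F i))%E].
  move=> i; apply: small_set_event => //; last by rewrite ltW.
  by move=> n; exact: (PQ n).2.
have h0 i : (0 <= hterm s (F i))%E.
  by rewrite /hterm; case: asboolP => // _; rewrite lee_fin powR_ge0.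
rewrite -(@lee_pmul2l _ 36%:E)// -EFinM divff// -PE -nneseriesZl//.
have mV i : measurable (V i) by case: (HV i).
(* The preimage of [E], of probability 1, lies in the null set [B] together with the events
   [V i]. *)
apply: (@le_trans _ _ (P (B `|` \bigcup_i V i))).
  apply: le_measure; rewrite ?inE//; first by apply: measurableU => //; apply: bigcupT_measurable.
  move=> w /= Ew; have [tw|ntw] := pselect (typical Q U x w); last by left; apply: sB.
  by right; have [i _ Fi] := EF _ Ew; exists i => //; case: (HV i) => _ + _; apply.
apply: (le_trans (measureU2 P mB _)); first exact: bigcupT_measurable.
rewrite [X in (X + _)%E]PB add0e.
apply: (@le_trans _ _ (\sum_(0 <= i <oo) P (V i))%E).
  by apply: measure_sigma_subadditive => //; apply: bigcupT_measurable.
by apply: lee_nneseries => i _; [move=> _; exact: measure_ge0|case: (HV i)].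
Qed.
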